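(* Let $M,C$ be positive integers, let $k=2r+1$ be an odd positive integer, let $N\geq k$, and consider stride $S=1$ with the zero-padding 'same' boundary condition. Let $d\in\{1,2\}$, and let $\mathbf{K}$ be a kernel tensor, in $\mathbb{R}^{M\times C\times k}$ if $d=1$ and in $\mathbb{R}^{M\times C\times k\times k}$ if $d=2$. Both in the RO case ($M\le C$) and in the CO case ($M\geq C$): if the layer transform matrix $\mathcal{K}$ is orthogonal, then there exist $(\alpha_{m,c})_{1\le m\le M,1\le c\le C}\in\mathbb{R}^{M\times C}$ such that for all $(m,c)$, $\mathbf{K}_{m,c}=\alpha_{m,c}\,e_{r,r}$ when $d=2$ (respectively $\mathbf{K}_{m,c}=\alpha_{m,c}\,e_r$ when $d=1$). As a consequence, $$\mathcal{K}=\begin{pmatrix}\alpha_{1,1}\mathrm{Id}_{N^d}&\cdots&\alpha_{1,C}\mathrm{Id}_{N^d}\\ \vdots& &\vdots\\ \alpha_{M,1}\mathrm{Id}_{N^d}&\cdots&\alpha_{M,C}\mathrm{Id}_{N^d}\end{pmatrix}\in\mathbb{R}^{MN^d\times CN^d}.$$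
   Context: Spatial indices of kernels run from $0$ to $k-1$; $(e_{i,j})_{0\le i,j\le k-1}$ is the canonical basis of $\mathbb{R}^{k\times k}$ and $(e_i)_{0\le i\le k-1}$ that of $\mathbb{R}^k$. $\mathbf{K}_{m,c}$ denotes the kernel from input channel $c$ to output channel $m$ (an element of $\mathbb{R}^k$ or $\mathbb{R}^{k\times k}$). With zero-padding 'same' and stride $1$: for $d=1$, $\mathcal{K}\in\mathbb{R}^{MN\times CN}$ is the matrix of the linear map $X\in\mathbb{R}^{C\times N}\mapsto Y\in\mathbb{R}^{M\times N}$, $Y_{m,i}=\sum_{c=1}^C\sum_{i'=0}^{k-1}\mathbf{K}_{m,c,i'}X_{c,i+i'-r}$ for $0\le i\le N-1$; for $d=2$, $\mathcal{K}\in\mathbb{R}^{MN^2\times CN^2}$ is the matrix of the linear map $X\in\mathbb{R}^{C\times N\times N}\mapsto Y\in\mathbb{R}^{M\times N\times N}$, $Y_{m,i,j}=\sum_{c=1}^C\sum_{i'=0}^{k-1}\sum_{j'=0}^{k-1}\mathbf{K}_{m,c,i',j'}X_{c,i+i'-r,j+j'-r}$ for $0\le i,j\le N-1$. Here entries of $X$ with a spatial index outside $\{0,\dots,N-1\}$ are taken to be $0$. Vectorization is channel by channel, with the same ordering of the $N^d$ spatial positions for input and output channels, so that $\mathcal{K}$ is an $M\times C$ array of blocks of size $N^d\times N^d$. Orthogonality: if $M\le C$ (RO case), $\mathcal{K}$ is orthogonal when $\mathcal{K}\mathcal{K}^T=\mathrm{Id}_{MN^d}$; if $M\geq C$ (CO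 case), $\mathcal{K}$ is orthogonal when $\mathcal{K}^T\mathcal{K}=\mathrm{Id}_{CN^d}$. *)

(* Defs.v *)
From HB Require Import structures.
From mathcomp Require Import all_boot all_order all_algebra.
From mathcomp Require Import reals.
Set Implicit Arguments.
Unset Strict Implicit.
Unset Printing Implicit Defensive.
Import Order.TTheory GRing.Theory Num.Theory.
Local Open Scope ring_scope.

(* Index r of the centre of a kernel of size k = 2r+1. *)
Definition centre (r : nat) : 'I_((2 * r).+1) := inord r.

Definition pos_of_int (N : nat) (z : int) : option 'I_N :=
  if z is Posz j then insub j else None.

(* Zero padding: x is extended by 0 outside {0,...,N-1}. *)
Definition zpad (R : nmodType) (N : nat) (x : 'I_N -> R) (z : int) : R :=
  oapp x 0 (pos_of_int N z).

Definition zpad2 (R : nmodType) (N : nat) (x : 'I_N -> 'I_N -> R) (z w : int)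
  : R := zpad (fun i => zpad (x i) w) z.

Definition conv1 (R : realType) (M C r N : nat)
    (K : 'I_M -> 'I_C -> 'rV[R]_((2 * r).+1)) (X : 'M[R]_(C, N)) :
    'M[R]_(M, N) :=
  \matrix_(m, i) \sum_(c < C) \sum_(i' < (2 * r).+1)
    K m c 0 i' * zpad (X c) (i%:Z + i'%:Z - r%:Z).

Definition conv2 (R : realType) (M C r N : nat)
    (K : 'I_M -> 'I_C -> 'M[R]_((2 * r).+1)) (X : {ffun 'I_C -> 'M[R]_N}) :
    {ffun 'I_M -> 'M[R]_N} :=
  [ffun m => \matrix_(i, j) \sum_(c < C) \sum_(i' < (2 * r).+1) \sum_(j' < (2 * r).+1)
    K m c i' j' * zpad2 (X c) (i%:Z + i'%:Z - r%:Z) (j%:Z + j'%:Z - r%:Z)].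

(* Channel-by-channel vectorization of 2D signals; for 1D signals, which are
   matrices, this is mxvec. *)
Definition vec2 (R : Type) (D N : nat) (X : {ffun 'I_D -> 'M[R]_N}) :
    'rV[R]_(D * (N * N)) :=
  mxvec (\matrix_(c < D) mxvec (X c)).

Definition unvec2 (R : Type) (D N : nat) (v : 'rV[R]_(D * (N * N))) :
    {ffun 'I_D -> 'M[R]_N} :=
  [ffun c => vec_mx (row c (vec_mx v))].

(* MathComp's matrices of linear maps act on row vectors, whence the
   transposes: layer_mx1P and layer_mx2P give the action on columns. *)
Definition layer_mx1 (R : realType) (M C r N : nat)
    (K : 'I_M -> 'I_C -> 'rV[R]_((2 * r).+1)) : 'M[R]_(M * N, C * N) :=
  (lin_mx (@conv1 R M C r N K))^T.

Definition layer_mx2 (R : realType) (M C r N : nat)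
    (K : 'I_M -> 'I_C -> 'M[R]_((2 * r).+1)) : 'M[R]_(M * (N * N), C * (N * N)) :=
  (lin1_mx (fun v => vec2 (@conv2 R M C r N K (unvec2 v))))^T.

(* P is the number N^d of spatial positions. The first case is RO, the second
   one CO; when M = C the two equations are equivalent. *)
Definition orthogonal_layer (R : realType) (M C P : nat)
    (A : 'M[R]_(M * P, C * P)) : Prop :=
  ((M <= C)%N /\ A *m A^T = 1%:M) \/ ((C <= M)%N /\ A^T *m A = 1%:M).

Lemma sum_const_ord (M P : nat) : (\sum_(m < M) P)%N = (M * P)%N.
Proof. by rewrite sum_nat_const card_ord. Qed.

(* The cast is needed because \mxblock has size \sum_(m < M) P, not M * P. *)
Definition blockmx (R : Type) (M C P : nat) (B : 'I_M -> 'I_C -> 'M[R]_P) :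
    'M[R]_(M * P, C * P) :=
  castmx (sum_const_ord M P, sum_const_ord C P)
    (\mxblock_(m < M, c < C) B m c).

Lemma zpadD (R : nmodType) (N : nat) (x y : 'I_N -> R) z :
  zpad (fun i => x i + y i) z = zpad x z + zpad y z.
Proof. by rewrite /zpad; case: pos_of_int => //=; rewrite addr0. Qed.

Lemma zpadZ (R : pzRingType) (N : nat) (a : R) (x : 'I_N -> R) z :
  zpad (fun i => a * x i) z = a * zpad x z.
Proof. by rewrite /zpad; case: pos_of_int => //=; rewrite mulr0. Qed.

Lemma eq_zpad (R : nmodType) (N : nat) (x y : 'I_N -> R) z :
  x =1 y -> zpad x z = zpad y z.
Proof. by move=> e; rewrite /zpad; case: pos_of_int => /=. Qed.

Lemma conv1_linear (R : realType) (M C r N : nat) K :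
  linear (@conv1 R M C r N K).
Proof.
move=> a X Y; apply/matrixP=> m i; rewrite !mxE mulr_sumr -big_split /=.
apply: eq_bigr => c _; rewrite mulr_sumr -big_split; apply: eq_bigr => j _ /=.
rewrite (@eq_zpad _ _ _ (fun i => a * X c i + Y c i)) => [|l]; last by rewrite !mxE.
by rewrite zpadD zpadZ mulrDr mulrCA.
Qed.

Lemma conv2_linear (R : realType) (M C r N : nat) K a X Y :
  @conv2 R M C r N K (a *: X + Y) = a *: conv2 K X + conv2 K Y.
Proof.
apply/ffunP=> m; apply/matrixP=> i j; rewrite !ffunE !mxE mulr_sumr -big_split /=.
apply: eq_bigr => c _; rewrite mulr_sumr -big_split; apply: eq_bigr => i' _ /=.
rewrite mulr_sumr -big_split; apply: eq_bigr => j' _ /=.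
set z := i%:Z + _ - _; set w := j%:Z + _ - _.
have -> : zpad2 ((a *: X + Y) c) z w = a * zpad2 (X c) z w + zpad2 (Y c) z w.
  rewrite /zpad2 -zpadZ -zpadD; apply: eq_zpad => l; rewrite -zpadZ -zpadD.
  by apply: eq_zpad => n; rewrite !ffunE !mxE.
by rewrite mulrDr mulrCA.
Qed.

Lemma vec2K (R : Type) (D N : nat) : cancel (@vec2 R D N) (@unvec2 R D N).
Proof. by move=> X; apply/ffunP=> c; rewrite ffunE mxvecK rowK mxvecK. Qed.

Lemma vec2_linear (R : pzRingType) (D N : nat) a (X Y : {ffun 'I_D -> 'M[R]_N}) :
  vec2 (a *: X + Y) = a *: vec2 X + vec2 Y.
Proof.
rewrite /vec2 -linearP; congr mxvec; apply/row_matrixP=> c.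
by rewrite linearP /= !rowK !ffunE linearP.
Qed.

Lemma unvec2_linear (R : pzRingType) (D N : nat) a (u v : 'rV[R]_(D * (N * N))) :
  unvec2 (a *: u + v) = a *: unvec2 u + unvec2 v.
Proof. by apply/ffunP=> c; rewrite !ffunE !linearP. Qed.

Lemma layer_mx1P (R : realType) (M C r N : nat) K (X : 'M[R]_(C, N)) :
  @layer_mx1 R M C r N K *m (mxvec X)^T = (mxvec (conv1 K X))^T.
Proof.
pose Lc := GRing.isLinear.Build _ _ _ _ _ (@conv1_linear R M C r N K).
pose f : {linear 'M[R]_(C, N) -> 'M[R]_(M, N)} := HB.pack (@conv1 R M C r N K) Lc.
by rewrite /layer_mx1 -trmx_mul (mul_vec_lin f).
Qed.

Lemma layer_mx2P (R : realType) (M C r N : nat) K (X : {ffun 'I_C -> 'M[R]_N}) :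
  @layer_mx2 R M C r N K *m (vec2 X)^T = (vec2 (conv2 K X))^T.
Proof.
pose g v := vec2 (@conv2 R M C r N K (unvec2 v)).
have gL : linear g.
  by move=> a u v; rewrite /g unvec2_linear conv2_linear vec2_linear.
pose f : {linear 'rV[R]_(C * (N * N)) -> 'rV[R]_(M * (N * N))} :=
  HB.pack g (GRing.isLinear.Build _ _ _ _ g gL).
by rewrite /layer_mx2 -trmx_mul (mul_rV_lin1 f) /= /g vec2K.
Qed.

Lemma val_mxvec_index (M P : nat) (m : 'I_M) (p : 'I_P) :
  mxvec_index m p = (m * P + p)%N :> nat.
Proof.
have idx (s1 : seq 'I_M) (s2 : seq 'I_P) : m \in s1 -> p \in s2 ->
    index (m, p) [seq (x, y) | x <- s1, y <- s2]
    = (index m s1 * size s2 + index p s2)%N.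
  elim: s1 => //= x s IHs; rewrite inE index_cat => ms ps.
  have [<-{IHs ms}|nxm] := eqVneq x m.
    by rewrite map_f // index_map // => y z [].
  have /negPf -> : (m, p) \notin [seq (x, y) | y <- s2].
    by apply/mapP=> -[y _ [/esym/eqP]]; rewrite (negPf nxm).
  rewrite size_map IHs //; first by rewrite mulSn addnA.
  by move: ms; rewrite eq_sym (negPf nxm).
have enE : enum {: 'I_M * 'I_P}
    = [seq (x, y) | x <- enum 'I_M, y <- enum 'I_P].
  by rewrite enumT [in LHS]unlock.
rewrite /= /enum_rank enum_rank_in.unlock insubdK; last first.
  by rewrite [_ \in _]/= -topredE /= cardE index_mem mem_enum.
rewrite [X in index _ X]enE idx ?mem_enum // size_enum_ord.
by rewrite !index_enum_ord.
Qed.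

Lemma blockmxE (R : Type) (M C P : nat) (B : 'I_M -> 'I_C -> 'M[R]_P) m p c q :
  blockmx B (mxvec_index m p) (mxvec_index c q) = B m c p q.
Proof.
have E n (i : 'I_n) (j : 'I_P) :
    cast_ord (esym (sum_const_ord n P)) (mxvec_index i j)
    = @tagnat.Rank n (fun=> P) i j.
  apply/val_inj/(etrans (val_mxvec_index i j)); apply/esym.
  apply: (etrans (tagnat.RankEsum (p_ := fun=> P) j)) => /=.
  by rewrite -(big_ord_widen n (fun=> P)) ?(ltnW (ltn_ord i)) // sum_const_ord.
rewrite castmxE !E.
have := congr1 (fun A : 'M_(_, _) => A p q)
  (mxblockK (p_ := fun=> P) (q_ := fun=> P) B m c).
by rewrite /submxblock mxE.
Qed.

(* Main.v *)
(* Orthogonality is used only through the norms of the rows (RO) or columns (CO)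
   of the layer matrix. The row at an interior position contains every kernel
   coefficient once, while zero padding leaves at the corner (0,...,0) only the
   indices >= r, and at (N-1,...,N-1) only those <= r. All these rows have norm
   1, so the coefficients missing at either corner vanish, and only the centre
   survives. *)
Require Import Defs.
From mathcomp Require Import all_boot all_order all_algebra.
From mathcomp Require Import reals.
From mathcomp Require Import zify.
Set Implicit Arguments.
Unset Strict Implicit.
Unset Printing Implicit Defensive.
Import Order.TTheory GRing.Theory Num.Theory.
Local Open Scope ring_scope.

(** * Zero padding as a sum of indicators *)

Lemma zpadE (R : nmodType) (N : nat) (x : 'I_N -> R) (z : int) :
  zpad x z = \sum_(j < N) x j *+ (j%:Z == z).
Proof.
rewrite /zpad /pos_of_int; case: z => [n|n]; last by rewrite big1.
case: insubP => [j _ <-|nN] /=.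
  rewrite (bigD1 j) //= eqxx big1 ?addr0 // => i ij.
  by case: eqP => // -[/val_inj e]; rewrite e eqxx in ij.
rewrite big1 // => i _; case: eqP => // -[e].
by rewrite -e ltn_ord in nN.
Qed.

Lemma zpad2E (R : nmodType) (N : nat) (x : 'I_N -> 'I_N -> R) (z w : int) :
  zpad2 x z w = \sum_(i < N) \sum_(j < N) x i j *+ ((i%:Z == z) && (j%:Z == w)).
Proof.
rewrite /zpad2 zpadE; apply: eq_bigr => i _; rewrite zpadE -sumrMnl.
by apply: eq_bigr => j _; rewrite -mulrnA mulnb andbC.
Qed.

Lemma zpad_comp (R S : nmodType) (N : nat) (h : R -> S) (x : 'I_N -> R) z :
  h 0 = 0 -> zpad (h \o x) z = h (zpad x z).
Proof. by rewrite /zpad => h0; case: pos_of_int. Qed.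

Lemma zpad_sum (R : nmodType) (N : nat) (I : finType) (x : 'I_N -> I -> R) z :
  zpad (fun i => \sum_l x i l) z = \sum_l zpad (x^~ l) z.
Proof. by rewrite /zpad; case: pos_of_int => //=; rewrite big1. Qed.

(** Kernel index linking output position [n] to input position [n']. It stays in [int] so that
    [zpad], applied to the kernel itself, gives 0 when the two positions are too far apart. *)
Definition offset (r n n' : nat) : int := n'%:Z - n%:Z + r%:Z.

(** Exchanging the two positions turns an offset [t] into [2r - t], which is what [rev_ord] does. *)
Lemma offset_rev (R : nmodType) (r i l : nat) (x : 'I_(2 * r).+1 -> R) :
  zpad (x \o @rev_ord _) (offset r l i) = zpad x (offset r i l).
Proof.
rewrite !zpadE (reindex_inj rev_ord_inj) /=; apply: eq_bigr => j _.
rewrite rev_ordK; congr (_ *+ nat_of_bool _).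
by rewrite /offset; apply/eqP/eqP; have := ltn_ord j; lia.
Qed.

(** Says that [i + j - r] is a genuine input position; adding [r] throughout avoids truncated
    subtraction. *)
Definition window (r N i j : nat) : bool := (r <= i + j < N + r)%N.

Lemma sum_zpad_offset (R : nmodType) (r N i : nat) (x : 'I_(2 * r).+1 -> R) :
  \sum_(l < N) zpad x (offset r i l)
  = \sum_(j < (2 * r).+1 | window r N i j) x j.
Proof.
under eq_bigr do rewrite zpadE.
rewrite exchange_big [RHS]big_mkcond /=; apply: eq_bigr => j _.
(* For fixed [j] only [l = i + j - r] can contribute, so the inner sum is the padding of a constant
   signal. *)
have -> : \sum_(l < N) x j *+ (j%:Z == offset r i l)
          = zpad (fun _ : 'I_N => x j) (i%:Z + j%:Z - r%:Z).
  rewrite zpadE; apply: eq_bigr => l _; congr (_ *+ nat_of_bool _).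
  by rewrite /offset; apply/eqP/eqP; lia.
rewrite /zpad /window /pos_of_int.
case E: (i%:Z + j%:Z - r%:Z) => [n|n].
  by case: insubP => [l nN _|nN] /=; case: ifP => //; lia.
by rewrite /=; case: ifP => //; lia.
Qed.

(** * From unit norms to the support of the kernel *)

Lemma vanish_off_window (R : realType) (D : nat) (J : finType) (P : pred J)
    (g : 'I_D -> J -> R) :
    \sum_c \sum_j g c j ^+ 2 = \sum_c \sum_(j | P j) g c j ^+ 2 ->
  forall c j, ~~ P j -> g c j = 0.
Proof.
move=> e c j nPj.
have : \sum_c \sum_(j | ~~ P j) g c j ^+ 2 = 0.
  apply: (addrI (\sum_c \sum_(j | P j) g c j ^+ 2)).
  rewrite addr0 -[RHS]e -big_split /=; apply: eq_bigr => c' _.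
  by rewrite [RHS](bigID P).
have ge0 c' : 0 <= \sum_(j | ~~ P j) g c' j ^+ 2.
  by apply: sumr_ge0 => ? _; apply: sqr_ge0.
move/(psumr_eq0P (fun c' _ => ge0 c'))/(_ c isT).
move/(psumr_eq0P (fun j' _ => sqr_ge0 (g c j')))/(_ j nPj)/eqP.
by rewrite sqrf_eq0 => /eqP.
Qed.

Lemma centre_window (r N : nat) (hN : ((2 * r).+1 <= N)%N) (j : 'I_(2 * r).+1) :
  [/\ window r N r j, window r N 0 j = (r <= j)%N
    & window r N N.-1 j = (j <= r)%N].
Proof. by have := ltn_ord j; rewrite /window; split; lia. Qed.

Lemma neq_centre (r : nat) (j : 'I_(2 * r).+1) :
  j != centre r -> ~~ (r <= j)%N || ~~ (j <= r)%N.
Proof. by rewrite -val_eqE /= /centre inordK; lia. Qed.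

(** The family [g] is arbitrary so that it can be a kernel row or a reversed kernel column. *)
Lemma support1 (R : realType) (D r N : nat) (hN : ((2 * r).+1 <= N)%N)
    (g : 'I_D -> 'I_(2 * r).+1 -> R) :
    (forall i : 'I_N, \sum_c \sum_(l < N) zpad (g c) (offset r i l) ^+ 2 = 1) ->
  forall c j, j != centre r -> g c j = 0.
Proof.
move=> g1.
(* Squaring fixes 0, hence commutes with padding: the norm becomes a sum over the window at [i]. *)
have {}g1 i : (i < N)%N ->
    \sum_c \sum_(j < (2 * r).+1 | window r N i j) g c j ^+ 2 = 1.
  move=> iN; rewrite -(g1 (Ordinal iN)); apply: eq_bigr => c _.
  rewrite -sum_zpad_offset; apply: eq_bigr => l _.
  by rewrite -(zpad_comp (h := fun x => x ^+ 2)) // expr0n.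
have g_full : \sum_c \sum_j g c j ^+ 2 = 1.
  rewrite -(g1 r); last by lia.
  apply: eq_bigr => c _; apply: eq_bigl => j.
  by have [->] := centre_window hN j.
have off i : (i < N)%N ->
    forall c (j : 'I_(2 * r).+1), ~~ window r N i j -> g c j = 0.
  by move=> iN; apply: vanish_off_window; rewrite g_full g1.
move=> c j /neq_centre; have [_ w0 wN] := centre_window hN j.
by case/orP; [rewrite -w0|rewrite -wN]; apply: off; lia.
Qed.

Lemma support2 (R : realType) (D r N : nat) (hN : ((2 * r).+1 <= N)%N)
    (g : 'I_D -> 'I_(2 * r).+1 -> 'I_(2 * r).+1 -> R) :
    (forall i i' : 'I_N, \sum_c \sum_(l < N) \sum_(l' < N)
       zpad2 (g c) (offset r i l) (offset r i' l') ^+ 2 = 1) ->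
  forall c j j', (j, j') != (centre r, centre r) -> g c j j' = 0.
Proof.
move=> g1.
pose G c (p : 'I_(2 * r).+1 * 'I_(2 * r).+1) := g c p.1 p.2.
(* The interior position and both corners lie on the diagonal, so one [i] drives both windows. *)
pose W i (p : 'I_(2 * r).+1 * 'I_(2 * r).+1) :=
  window r N i p.1 && window r N i p.2.
have {}g1 i : (i < N)%N -> \sum_c \sum_(p | W i p) G c p ^+ 2 = 1.
  move=> iN; rewrite -(g1 (Ordinal iN) (Ordinal iN)); apply: eq_bigr => c _.
  rewrite -(pair_big (fun j => window r N i (val j))
    (fun j => window r N i (val j)) (fun j j' => g c j j' ^+ 2)) /=.
  under eq_bigr do rewrite -sum_zpad_offset.
  rewrite -sum_zpad_offset; apply: eq_bigr => l _.
  rewrite zpad_sum; apply: eq_bigr => l' _.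
  rewrite /zpad2 -(zpad_comp (h := fun x => x ^+ 2)) ?expr0n //.
  apply: eq_zpad => j /=.
  by rewrite -(zpad_comp (h := fun x => x ^+ 2)) // expr0n.
have g_full : \sum_c \sum_p G c p ^+ 2 = 1.
  rewrite -(g1 r); last by lia.
  apply: eq_bigr => c _; apply: eq_bigl => -[j j']; rewrite /W /=.
  by have [-> _ _] := centre_window hN j; have [-> _ _] := centre_window hN j'.
have off i : (i < N)%N -> forall c p, ~~ W i p -> G c p = 0.
  by move=> iN; apply: vanish_off_window; rewrite g_full g1.
move=> c j j'; rewrite xpair_eqE negb_and => jj'.
have [_ w0 wN] := centre_window hN j; have [_ w0' wN'] := centre_window hN j'.
(* One coordinate differing from [r] is enough for the pair to be missed at one of the two
   corners. *)
suff : ~~ ((r <= j) && (r <= j'))%N || ~~ ((j <= r) && (j' <= r))%N.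
  case/orP; [rewrite -w0 -w0'|rewrite -wN -wN'] => nw;
    by apply: (off _ _ c (j, j') nw); lia.
by case/orP: jj' => /neq_centre; lia.
Qed.

(** * Entries of the layer matrix *)

Lemma col_entry (R : pzRingType) (m n : nat) (A : 'M[R]_(m, n)) i j :
  A i j = (A *m (delta_mx 0 j : 'rV_n)^T) i 0.
Proof. by rewrite trmx_delta -colE mxE. Qed.

Lemma zpad_delta (R : pzSemiRingType) (D N : nat) (c c' : 'I_D) (l : 'I_N) z :
  zpad ((delta_mx c l : 'M[R]_(D, N)) c') z = ((c' == c) && (l%:Z == z))%:R.
Proof.
rewrite zpadE (bigD1 l) //= big1 => [|l' l'l].
  by rewrite mxE eqxx andbT addr0 -mulrnA mulnb.
by rewrite mxE (negPf l'l) andbF mul0rn.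
Qed.

Lemma zpad2_delta (R : pzSemiRingType) (N : nat) (l l' : 'I_N) z w :
  zpad2 (delta_mx l l' : 'M[R]_N) z w = ((l%:Z == z) && (l'%:Z == w))%:R.
Proof.
rewrite /zpad2 zpadE (bigD1 l) //= big1 => [|a al].
  by rewrite zpad_delta eqxx addr0 -mulrnA mulnb andbC.
by rewrite zpad_delta (negPf al) mul0rn.
Qed.

Lemma eq_offset (r i j l : nat) :
  (l%:Z == i%:Z + j%:Z - r%:Z) = (j%:Z == offset r i l).
Proof. by rewrite /offset; apply/eqP/eqP; lia. Qed.

(** Convolving a basis signal keeps only channel [c] and the kernel index that reaches [l] from
    [i]. *)
Lemma layer_mx1E (R : realType) (M C r N : nat)
    (K : 'I_M -> 'I_C -> 'rV[R]_((2 * r).+1)) m i c l :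
  layer_mx1 N K (mxvec_index m i) (mxvec_index c l)
  = zpad (K m c 0) (offset r i l).
Proof.
rewrite col_entry -mxvec_delta layer_mx1P mxE mxvecE mxE zpadE.
rewrite (bigD1 c) //= [X in _ + X]big1 ?addr0 => [|c' c'c].
  apply: eq_bigr => j _.
  by rewrite zpad_delta eqxx eq_offset mulrnAr mulr1.
by apply: big1 => j _; rewrite zpad_delta (negPf c'c) mulr0.
Qed.

Lemma layer_mx2E (R : realType) (M C r N : nat)
    (K : 'I_M -> 'I_C -> 'M[R]_((2 * r).+1)) m i i' c l l' :
  layer_mx2 N K (mxvec_index m (mxvec_index i i'))
    (mxvec_index c (mxvec_index l l'))
  = zpad2 (K m c) (offset r i l) (offset r i' l').
Proof.
(* The basis signal at channel [c] and position [(l, l')], in the form that [vec2] accepts. *)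
pose X : {ffun 'I_C -> 'M[R]_N} :=
  [ffun c' => (c' == c)%:R *: delta_mx l l'].
rewrite col_entry -mxvec_delta.
have -> : delta_mx c (mxvec_index l l') = \matrix_c' mxvec (X c').
  apply/row_matrixP=> c'; rewrite rowK ffunE linearZ /= mxvec_delta.
  apply/rowP=> q.
  by rewrite !mxE eqxx -natrM mulnb.
rewrite layer_mx2P mxE mxvecE mxE mxvecE ffunE mxE.
rewrite (bigD1 c) //= [X in _ + X]big1 ?addr0 => [|c' c'c].
  rewrite zpad2E; apply: eq_bigr => j _; apply: eq_bigr => j' _.
  by rewrite ffunE eqxx scale1r zpad2_delta !eq_offset mulrnAr mulr1.
apply: big1 => j _; apply: big1 => j' _.
rewrite ffunE (negPf c'c) scale0r zpad2E big1 ?mulr0 // => a _.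
by rewrite big1 // => b _; rewrite mxE mul0rn.
Qed.

(** * Orthogonality as unit norms of rows or columns *)

Lemma sum_mxvec_index (V : nmodType) (m n : nat) (F : 'I_(m * n) -> V) :
  \sum_q F q = \sum_i \sum_j F (mxvec_index i j).
Proof.
rewrite (reindex _ (curry_mxvec_bij m n)) /= pair_bigA /=.
by apply: eq_bigr => -[].
Qed.

Lemma row_norm (R : realType) (m n : nat) (A : 'M[R]_(m, n)) :
  A *m A^T = 1%:M -> forall p, \sum_q A p q ^+ 2 = 1.
Proof.
move=> /matrixP A1 p; have := A1 p p; rewrite !mxE eqxx mulr1n => <-.
by apply: eq_bigr => q _; rewrite mxE expr2.
Qed.

Lemma col_norm (R : realType) (m n : nat) (A : 'M[R]_(m, n)) :
  A^T *m A = 1%:M -> forall q, \sum_p A p q ^+ 2 = 1.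
Proof.
move=> A1 q; rewrite -[RHS](@row_norm _ _ _ A^T _ q) ?trmxK //.
by apply: eq_bigr => p _; rewrite mxE.
Qed.

Lemma offset_rev2 (R : nmodType) (r i l i' l' : nat)
    (x : 'I_(2 * r).+1 -> 'I_(2 * r).+1 -> R) :
  zpad2 (fun j j' => x (rev_ord j) (rev_ord j')) (offset r l i) (offset r l' i')
  = zpad2 x (offset r i l) (offset r i' l').
Proof.
rewrite /zpad2 -[RHS]offset_rev; apply: eq_zpad => j /=.
by rewrite -[RHS]offset_rev.
Qed.

Lemma rev_centre (r : nat) : rev_ord (centre r) = centre r.
Proof. by apply: val_inj; rewrite /= /centre inordK; lia. Qed.

(* The columns of the layer matrix are rows of the layer with the transposed
   and spatially reversed kernel, so RO and CO reduce to the same lemma. *)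
Lemma orthogonal_support1 (R : realType) (M C r N : nat)
    (hN : ((2 * r).+1 <= N)%N) (K : 'I_M -> 'I_C -> 'rV[R]_((2 * r).+1)) :
    orthogonal_layer (layer_mx1 N K) ->
  forall m c j, j != centre r -> K m c 0 j = 0.
Proof.
case=> -[_ A1] m c j jr.
  apply: (support1 hN (g := fun c => K m c 0)) jr => i.
  rewrite -(row_norm A1 (mxvec_index m i)) sum_mxvec_index.
  by apply: eq_bigr => c' _; apply: eq_bigr => l _; rewrite layer_mx1E.
(* CO case: the input channel [c] is fixed, and the goal becomes the reversed kernel evaluated at
   [rev_ord j]. *)
rewrite -[j]rev_ordK.
apply: (support1 hN (g := fun m j => K m c 0 (rev_ord j))); last first.
  by rewrite -rev_centre (inj_eq rev_ord_inj).
move=> l; rewrite -(col_norm A1 (mxvec_index c l)) sum_mxvec_index.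
apply: eq_bigr => m' _; apply: eq_bigr => i _.
by rewrite layer_mx1E -[in RHS]offset_rev.
Qed.

Lemma orthogonal_support2 (R : realType) (M C r N : nat)
    (hN : ((2 * r).+1 <= N)%N) (K : 'I_M -> 'I_C -> 'M[R]_((2 * r).+1)) :
    orthogonal_layer (layer_mx2 N K) ->
  forall m c j j', (j, j') != (centre r, centre r) -> K m c j j' = 0.
Proof.
case=> -[_ A1] m c j j' jr.
  apply: (support2 hN (g := fun c => K m c)) jr => i i'.
  rewrite -(row_norm A1 (mxvec_index m (mxvec_index i i'))) sum_mxvec_index.
  apply: eq_bigr => c' _; rewrite sum_mxvec_index.
  by do 2!apply: eq_bigr => ? _; rewrite layer_mx2E.
rewrite -[j]rev_ordK -[j']rev_ordK.
apply: (support2 hN (g := fun m j j' => K m c (rev_ord j) (rev_ord j'))).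
  move=> l l'; rewrite -(col_norm A1 (mxvec_index c (mxvec_index l l'))).
  rewrite sum_mxvec_index; apply: eq_bigr => m' _; rewrite sum_mxvec_index.
  by do 2!apply: eq_bigr => ? _; rewrite layer_mx2E -[in RHS]offset_rev2.
by rewrite -rev_centre xpair_eqE !(inj_eq rev_ord_inj).
Qed.

(** The central coefficient acts only on the diagonal of a block, which makes every block scalar. *)
Lemma centre_offset (r i l : nat) : ((centre r)%:Z == offset r i l) = (i == l).
Proof.
by rewrite /offset /centre inordK; [apply/eqP/eqP|]; lia.
Qed.

Theorem proposition6 (R : realType) (M C r N : nat)
    (hM : (0 < M)%N) (hC : (0 < C)%N) (hN : ((2 * r).+1 <= N)%N) :
  (forall K : 'I_M -> 'I_C -> 'rV[R]_((2 * r).+1),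
     orthogonal_layer (layer_mx1 N K) ->
     exists alpha : 'M[R]_(M, C),
       (forall m c, K m c = alpha m c *: delta_mx 0 (centre r)) /\
       layer_mx1 N K = blockmx (fun m c => (alpha m c)%:M)) /\
  (forall K : 'I_M -> 'I_C -> 'M[R]_((2 * r).+1),
     orthogonal_layer (layer_mx2 N K) ->
     exists alpha : 'M[R]_(M, C),
       (forall m c, K m c = alpha m c *: delta_mx (centre r) (centre r)) /\
       layer_mx2 N K = blockmx (fun m c => (alpha m c)%:M)).
Proof.
split=> K orthK.
  have K0 := orthogonal_support1 hN orthK.
  exists (\matrix_(m, c) K m c 0 (centre r)); split=> [m c|].
    apply/rowP=> j; rewrite !mxE.
    by have [->|/K0->] := eqVneq j (centre r); rewrite ?mulr1 ?mulr0.
  apply/matrixP; case/mxvec_indexP=> m i; case/mxvec_indexP=> c l.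
  (* Only the central term of the padding sum survives. *)
  rewrite layer_mx1E blockmxE !mxE zpadE (bigD1 (centre r)) //=.
  rewrite big1 => [|j /K0->]; last by rewrite mul0rn.
  by rewrite addr0 centre_offset.
have K0 := orthogonal_support2 hN orthK.
exists (\matrix_(m, c) K m c (centre r) (centre r)); split=> [m c|].
  apply/matrixP=> j j'; rewrite !mxE -xpair_eqE.
  by have [[-> ->]|/K0->] := eqVneq (j, j') (centre r, centre r);
    rewrite ?mulr1 ?mulr0.
apply/matrixP; case/mxvec_indexP=> m p; case/mxvec_indexP=> c q.
case/mxvec_indexP: p => i i'; case/mxvec_indexP: q => l l'.
rewrite layer_mx2E blockmxE !mxE zpad2E pair_bigA /=.
rewrite (bigD1 (centre r, centre r)) //= big1 => [|[j j'] /K0->]; last first.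
  by rewrite mul0rn.
rewrite addr0 !centre_offset -[(i == l) && _]xpair_eqE.
(* Vectorized positions agree exactly when the pairs do, since [mxvec_index] is a cast of the
   injective [enum_rank]. *)
by rewrite (inj_eq (@cast_ord_inj _ _ _)) (inj_eq enum_rank_inj).
Qed.
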